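(* There exist a complex manifold $\mathfrak{M}$, a piecewise smooth domain $\Omega\Subset\mathfrak{M}$ with non-generic corners, and a holomorphic function $f$ of polynomial growth on $\Omega$, such that the boundary current $\mathsf{bc} f$ of $f$ does not exist; that is, there is no $(0,1)$-current $\gamma\in\mathcal{D}'_{0,1}(\mathfrak{M})$ with the following property, where $n=\dim_{\mathbb{C}}\mathfrak{M}$: whenever $U$ is a coordinate neighbourhood of $\mathfrak{M}$, $\psi\in\mathcal{D}^{n,n-1}(\mathfrak{M})$ is a smooth form with support in $U$, and $v\in\mathbb{C}^n$ is a vector which, in the coordinates on $U$, points outward from $\Omega$ along each $\partial\Omega_j$ inside $U$ (where $\Omega=\bigcap_{j=1}^N\Omega_j$ is the representation of $\Omega$ as an intersection of smoothly bounded domains), one has $$\langle \gamma,\psi\rangle=\lim_{\epsilon\downarrow 0}\int_{\partial\Omega} f_\epsilon\,\psi,\qquad f_\epsilon(z)=f(z-\epsilon v).$$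
   Context: Piecewise smooth domain: a relatively compact domain $\Omega$ in a complex manifold $\mathfrak{M}$ of complex dimension $n$, given in the form $\Omega=\bigcap_{j=1}^N\Omega_j$, where each $\Omega_j\subset\mathfrak{M}$ is a smoothly bounded domain, meaning a domain with $\mathcal{C}^\infty$-smooth boundary $\partial\Omega_j$ (also written $b\Omega_j$; $\Omega_j$ itself need not be relatively compact). Generic and non-generic corners: $\Omega=\bigcap_{j=1}^N\Omega_j$ is a domain with generic corners if for each subset $S\subset\{1,\dots,N\}$ the intersection $B_S=\bigcap_{j\in S}\partial\Omega_j$, if non-empty, is a CR manifold of CR-dimension $n-|S|$. The domain has non-generic corners if this condition fails. Polynomial growth: let $\mathrm{dist}(z,X)$ denote the distance from a point $z\in\mathfrak{M}$ to a set $X$ induced by some metric on $\mathfrak{M}$ compatible with its topology. A holomorphic function $f\in\mathcal{O}(\Omega)$ is of polynomial growth if there are $C>0$ and $k\ge 0$ such that $|f(z)|\le C/\mathrm{dist}(z,\partial\Omega)^k$ for each $z\in\Omega$. Currents: $\mathcal{D}^{n,n-1}(\mathfrak{M})$ is the space of smooth compactly supported $(n,n-1)$-forms on $\mathfrak{M}$ with its usual topology, and $\mathcal{D}'_{0,1}(\mathfrak{M})$, the space of $(0,1)$-currents, is its topological dual, with pairing $\langle\cdot,\cdot\rangle$. Boundary current: for $f$ of polynomial growth on $\Omega$, the boundary current $\mathsf{bc} f$ is a current $\gamma\in\mathcal{D}'_{0,1}(\mathfrak{M})$ with the property displayed in the claim. There, $z-\epsilon v$ is computed in the coordinates on $U$,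 the integral is over $\partial\Omega$ with its boundary orientation (only points in the support of $\psi$ contribute, and for these $f_\epsilon$ is defined when $\epsilon>0$ is small), and the equality includes the requirement that the limit exists as a finite complex number. *)

(* Defs.v *)
From HB Require Import structures.
From mathcomp Require Import all_boot all_order all_algebra.
From mathcomp Require Import complex.
From mathcomp Require Import all_classical all_reals all_analysis.

Set Implicit Arguments.
Unset Strict Implicit.
Unset Printing Implicit Defensive.

Import Order.TTheory GRing.Theory Num.Theory.
Import numFieldNormedType.Exports.

Local Open Scope classical_set_scope.
Local Open Scope ring_scope.
Local Open Scope complex_scope.

(* The topology and the norm of C = R[i], as a numeric field. *)
HB.instance Definition _ (R : rcfType) := PseudoMetric.copy R[i] R[i]^o.
HB.instance Definition _ (R : rcfType) := NormedModule.copy R[i] R[i]^o.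

(* C^n is 'rV[R[i]]_n.  Its underlying real space is R^(n + n), with the
   coordinates ordered (x_1, .., x_n, y_1, .., y_n), where z_j = x_j + i y_j. *)
Section Euclidean.
Context {R : realType}.
Local Notation C := R[i].

Definition of_real n (x : 'rV[R]_(n + n)) : 'rV[C]_n :=
  \row_j (x 0 (lshift n j) +i* x 0 (rshift n j)).

Definition to_real n (z : 'rV[C]_n) : 'rV[R]_(n + n) :=
  row_mx (map_mx (@complex.Re R) z) (map_mx (@complex.Im R) z).

(* The matrix of multiplication by i, acting on row vectors on the right:
   (x, y) *m mulJ = (- y, x). *)
Definition mulJ n : 'M[R]_(n + n) := block_mx 0 1%:M (- 1%:M) 0.

Definition partial k (a : 'I_k) (g : 'rV[R]_k -> R) : 'rV[R]_k -> R :=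
  fun x => 'D_(delta_mx 0 a) g x.

Definition iter_partial k (s : seq 'I_k) (g : 'rV[R]_k -> R) : 'rV[R]_k -> R :=
  foldr (@partial k) g s.

(* Co on A; only meaningful, and only used, for open A. *)
Definition smooth_on k (A : set 'rV[R]_k) (g : 'rV[R]_k -> R) : Prop :=
  forall (s : seq 'I_k) (x : 'rV[R]_k), A x ->
    {for x, continuous (iter_partial s g)} /\
    forall a, derivable (iter_partial s g) x (delta_mx 0 a).

Definition real_fun n (rho : 'rV[C]_n -> R) : 'rV[R]_(n + n) -> R :=
  fun x => rho (of_real x).

Definition smooth_on_C n (A : set 'rV[C]_n) (rho : 'rV[C]_n -> R) : Prop :=
  smooth_on (@of_real n @^-1` A) (real_fun rho).

Definition gradient n (rho : 'rV[C]_n -> R) (z : 'rV[C]_n) : 'rV[R]_(n + n) :=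
  \row_a partial a (real_fun rho) (to_real z).

(* Iterated Lebesgue integral over R^k. *)
Fixpoint integral_rV k : ('rV[R]_k -> R) -> R :=
  match k with
  | 0 => fun g => g 0
  | k'.+1 => fun g =>
      \int[@lebesgue_measure R]_t
        integral_rV (fun y : 'rV[R]_k' => g (row_mx (t%:M : 'rV[R]_1) y))
  end.

Definition integral_rV_C k (E : set 'rV[R]_k) (g : 'rV[R]_k -> C) : C :=
  integral_rV (fun x => \1_E x * complex.Re (g x)) +i*
  integral_rV (fun x => \1_E x * complex.Im (g x)).

Definition borel k (E : set 'rV[R]_k) : Prop := <<s @open 'rV[R]_k >> E.

(* Row a is the tangent vector d g / d x_a, in the coordinates (x, y). *)
Definition real_tangent k n (g : 'rV[R]_k -> 'rV[C]_n) (x : 'rV[R]_k) :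
    'M[R]_(k, n + n) :=
  \matrix_(a, b) partial a (fun y => to_real (g y) 0 b) x.

Definition tangent k n (g : 'rV[R]_k -> 'rV[C]_n) (x : 'rV[R]_k) :
    'M[C]_(k, n) :=
  \matrix_(a, j) of_real (row a (real_tangent g x)) 0 j.

End Euclidean.

(* Coefficients of (n, n-1)-forms, n = m + 1: w : C^n -> C^n stands for
     sum_j w_j dz_1 /\ .. /\ dz_n /\ dzb_1 /\ .. ^j .. /\ dzb_n
   where dzb_j is omitted from the j-th term. *)
Section Forms.
Context {R : realType} {m : nat}.
Local Notation C := R[i].
Local Notation Cn := 'rV[C]_m.+1.

(* Pullback by a holomorphic map F.  The library's jacobian acts on row
   vectors, so ('J F z) a k is d F_k / d z_a. *)
Definition pullback_hol (F : Cn -> Cn) (w : Cn -> Cn) (z : Cn) : Cn :=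
  let J : 'M[C]_m.+1 := jacobian F z in
  \det J *:
    (w (F z) *m \matrix_(k, j) conjc (\det (row' j (col' k J)))).

(* Pullback by a parametrization g of a real hypersurface: the coefficient of
   dx_1 /\ .. /\ dx_(2n-1), i.e. the form evaluated on the tangent vectors
   d g / d x_a.  Listing the n - 1 forms dzb before the n forms dz is an even
   permutation, because n (n - 1) is even. *)
Definition pullback_real (g : 'rV[R]_(m + m.+1) -> Cn) (w : Cn -> Cn)
    (x : 'rV[R]_(m + m.+1)) : C :=
  \sum_j w (g x) 0 j *
    \det (row_mx (col' j (map_mx conjc (tangent g x)) :
                    'M[C]_(m + m.+1, m))
                 (tangent g x)).

(* (nu, d g / d x_1, .., d g / d x_(2n-1)) is a positive frame for the complex
   orientation, i.e. for the order (x_1, y_1, .., x_n, y_n).  The sign is that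
   of the reordering into (x_1, .., x_n, y_1, .., y_n). *)
Definition positive_frame (nu : Cn) (g : 'rV[R]_(m + m.+1) -> Cn)
    (x : 'rV[R]_(m + m.+1)) : Prop :=
  let B : 'M[R]_(m.+1 + m.+1) := col_mx (to_real nu) (real_tangent g x) in
  0 < (-1) ^+ 'C(m.+1, 2) * \det B.

End Forms.

Section Charts.
Context {R : realType} {T : topologicalType} {n : nat}.
Local Notation C := R[i].

Record chart := Chart {
  chart_dom : set T;
  coord : T -> 'rV[C]_n;
  inv_coord : 'rV[C]_n -> T }.

Definition chart_img (c : chart) : set 'rV[C]_n := coord c @` chart_dom c.

Definition is_chart (c : chart) : Prop :=
  [/\ open (chart_dom c), open (chart_img c),
      forall p, chart_dom c p -> inv_coord c (coord c p) = p,
      forall p, chart_dom c p -> {for p, continuous (coord c)}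
    & forall z, chart_img c z -> {for z, continuous (inv_coord c)}].

Definition transition (c d : chart) : 'rV[C]_n -> 'rV[C]_n :=
  coord d \o inv_coord c.

Definition chart_overlap (c d : chart) : set 'rV[C]_n :=
  [set z | chart_img c z /\ chart_dom d (inv_coord c z)].

Definition holo_compatible (c d : chart) : Prop :=
  (forall z, chart_overlap c d z -> differentiable (transition c d) z) /\
  (forall z, chart_overlap d c z -> differentiable (transition d c) z).

End Charts.
Arguments chart : clear implicits.

Record complexManifold (R : realType) (n : nat) := ComplexManifold {
  carrier :> topologicalType;
  chart_index : Type;
  atlas : chart_index -> chart R carrier n;
  manifold_hausdorff : hausdorff_space carrier;
  manifold_countable : @second_countable carrier;
  atlas_chart : forall i, is_chart (atlas i);
  atlas_cover : forall p, exists i, chart_dom (atlas i) p;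
  atlas_compatible : forall i j, holo_compatible (atlas i) (atlas j) }.

Arguments atlas {R n} M i : rename.

Section Manifold.
Context {R : realType} {n : nat} (M : complexManifold R n).
Local Notation C := R[i].
Local Notation chartM := (chart R M n).

(* The coordinate neighbourhoods: all members of the maximal atlas. *)
Definition coordinate_chart (c : chartM) : Prop :=
  is_chart c /\ forall i, holo_compatible c (atlas M i).

Definition bdry (A : set M) : set M := closure A `\` interior A.

Definition is_domain (A : set M) : Prop :=
  [/\ open A, A !=set0 & connected A].

(* rho is, in the coordinates of c, a local defining function of A near p. *)
Definition defining_function (c : chartM) (A : set M) (p : M)
    (rho : 'rV[C]_n -> R) : Prop :=
  chart_dom c p /\
  exists V : set 'rV[C]_n,
    [/\ open V, V (coord c p) & V `<=` chart_img c] /\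
    [/\ smooth_on_C V rho,
        forall z, V z -> (A (inv_coord c z) <-> rho z < 0)
      & gradient rho (coord c p) != 0].

Definition smooth_boundary (A : set M) : Prop :=
  forall p, bdry A p ->
    exists c rho, coordinate_chart c /\ defining_function c A p rho.

(* v points out of A at p, transversally to the boundary. *)
Definition outward (c : chartM) (A : set M) (p : M) (v : 'rV[C]_n) : Prop :=
  exists2 rho, defining_function c A p rho &
    0 < (to_real v *m (gradient rho (coord c p))^T) 0 0.

Section PiecewiseSmooth.
Context {N : nat} (Om : 'I_N -> set M).

Definition total_domain : set M := [set p | forall j, Om j p].

Definition piecewise_smooth_domain : Prop :=
  [/\ (0 < N)%N,
      forall j, is_domain (Om j) /\ smooth_boundary (Om j),
      is_domain total_domain
    & compact (closure total_domain)].

(* B is an embedded submanifold, cut out locally by k functions with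
   independent differentials (the columns of D), and at each point its tangent
   space kermx D satisfies dim_R (T_p B :&: J T_p B) = 2 d. *)
Definition CR_manifold (B : set M) (d : nat) : Prop :=
  exists k : nat, forall p, B p ->
    exists (c : chartM) (V : set 'rV[C]_n) (rho : 'I_k -> 'rV[C]_n -> R),
      let D : 'M[R]_(n + n, k) :=
        \matrix_(a, b) gradient (rho b) (coord c p) 0 a in
      [/\ coordinate_chart c, chart_dom c p, open V, V (coord c p)
        & V `<=` chart_img c] /\
      [/\ forall b, smooth_on_C V (rho b),
          forall z, V z -> (B (inv_coord c z) <-> forall b, rho b z = 0),
          \rank D = k
        & \rank (kermx D :&: kermx (mulJ n *m D))%MS = d.*2].

Definition corner (S : {set 'I_N}) : set M :=
  [set p | forall j, j \in S -> bdry (Om j) p].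

(* The equation d + #|S| = n expresses CR-dimension n - #|S| without truncated
   subtraction; in particular a non-empty corner with n < #|S| is excluded. *)
Definition generic_corners : Prop :=
  forall S : {set 'I_N}, corner S !=set0 ->
    exists d, CR_manifold (corner S) d /\ (d + #|S| = n)%N.

End PiecewiseSmooth.

Definition holomorphic_on (A : set M) (f : M -> C) : Prop :=
  forall (i : chart_index M) z,
    chart_img (atlas M i) z -> A (inv_coord (atlas M i) z) ->
    differentiable (f \o inv_coord (atlas M i) : 'rV[C]_n -> C) z.

(* The last condition, local comparability with the Euclidean distance in
   coordinates, holds for the distances induced by Riemannian metrics; without
   it the topology alone would not determine what polynomial growth means. *)
Definition manifold_distance (dist : M -> M -> R) : Prop :=
  [/\ forall p q, 0 <= dist p q,
      forall p q, dist p q = 0 <-> p = q,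
      forall p q, dist p q = dist q p
    & forall p q r, dist p r <= dist p q + dist q r] /\
  (forall (p : M) (A : set M),
     nbhs p A <-> exists2 e : R, 0 < e & forall q, dist p q < e -> A q) /\
  (forall (i : chart_index M) p, chart_dom (atlas M i) p ->
     exists2 K : R, 0 < K & exists2 A : set M, nbhs p A &
       forall q r, A q -> A r ->
         let eucl := complex.Re `|coord (atlas M i) q - coord (atlas M i) r| in
         eucl <= K * dist q r /\ dist q r <= K * eucl).

Definition set_dist (dist : M -> M -> R) (p : M) (X : set M) : R :=
  inf [set dist p q | q in X].

Definition polynomial_growth (dist : M -> M -> R) (A : set M) (f : M -> C) :
    Prop :=
  exists K k : R, [/\ 0 < K, 0 <= k &
    forall p, A p -> Normc.normc (f p) <= K / set_dist dist p (bdry A) `^ k].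

End Manifold.

Section Currents.
Context {R : realType} {m : nat} (M : complexManifold R m.+1).
Local Notation C := R[i].
Local Notation Cn := 'rV[C]_m.+1.
Local Notation chartM := (chart R M m.+1).

(* An (n, n-1)-form on M is given by its coefficients in the charts of the
   atlas. *)
Definition nn1_form : Type := chart_index M -> Cn -> Cn.

(* h is the coefficient of psi in the coordinates of the chart c. *)
Definition coefficients (psi : nn1_form) (c : chartM) (h : Cn -> Cn) : Prop :=
  forall i z, chart_overlap c (atlas M i) z ->
    h z = pullback_hol (transition c (atlas M i)) (psi i) z.

Definition form_support (psi : nn1_form) : set M :=
  closure [set p | exists2 i, chart_dom (atlas M i) p
                            & psi i (coord (atlas M i) p) != 0].

(* Vanishing outside the image of the chart only normalizes the irrelevant
   values, so that equal forms are equal as functions. *)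
Definition test_form (psi : nn1_form) : Prop :=
  [/\ forall i, coefficients psi (atlas M i) (psi i),
      forall i z, ~ chart_img (atlas M i) z -> psi i z = 0,
      forall i j,
        let U := chart_img (atlas M i) in
        smooth_on_C U (fun z => complex.Re (psi i z 0 j)) /\
        smooth_on_C U (fun z => complex.Im (psi i z 0 j))
    & compact (form_support psi)].

(* All the derivatives of order <= r of the coefficients of psi in the i-th
   chart are bounded by b on the set L. *)
Definition seminorm_le (psi : nn1_form) (i : chart_index M) (L : set M)
    (r : nat) (b : R) : Prop :=
  forall (s : seq 'I_(m.+1 + m.+1)) j p, (size s <= r)%N -> L p ->
    let x := to_real (coord (atlas M i) p) in
    `|iter_partial s (real_fun (fun z => complex.Re (psi i z 0 j))) x| <= b /\
    `|iter_partial s (real_fun (fun z => complex.Im (psi i z 0 j))) x| <= b.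

(* Continuity for the inductive limit topology: on the forms supported in a
   fixed compact set, gamma is bounded by finitely many C^r seminorms. *)
Definition is_current (gamma : nn1_form -> C) : Prop :=
  (forall (a : C) psi1 psi2, test_form psi1 -> test_form psi2 ->
     gamma (fun i z => a *: psi1 i z + psi2 i z)
       = a * gamma psi1 + gamma psi2) /\
  (forall K : set M, compact K ->
     exists (q : nat) (idx : 'I_q -> chart_index M) (L : 'I_q -> set M)
            (r : nat) (A : R),
       (forall t, compact (L t) /\ L t `<=` chart_dom (atlas M (idx t))) /\
       forall psi (b : R), test_form psi -> form_support psi `<=` K -> 0 <= b ->
         (forall t, seminorm_le psi (idx t) (L t) r b) ->
         Normc.normc (gamma psi) <= A * b).

(* g parametrizes, in the coordinates of c, a piece of the boundary of A,
   compatibly with the boundary orientation (outward vector first).  Being an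
   immersion follows from positivity of the frame. *)
Definition boundary_parametrization (c : chartM) (A : set M)
    (W : set 'rV[R]_(m + m.+1)) (g : 'rV[R]_(m + m.+1) -> Cn) : Prop :=
  [/\ open W,
      forall b, smooth_on W (fun x => to_real (g x) 0 b),
      forall x y, W x -> W y -> g x = g y -> x = y
    & forall x, W x ->
        [/\ chart_img c (g x), bdry A (inv_coord c (g x))
          & exists2 nu, outward c A (inv_coord c (g x)) nu
                      & positive_frame nu g x]].

(* I is the integral over the boundary of Omega, inside the chart domain, of
   the form with coefficients w in the coordinates of c: where w is non-zero,
   the boundary is cut into finitely many disjoint Borel pieces g_t (E_t), each
   lying on one of the smooth hypersurfaces and parametrized with its boundary
   orientation. *)
Definition boundary_integral N (c : chartM) (Om : 'I_N -> set M)
    (w : Cn -> Cn) (I : C) : Prop :=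
  exists (q : nat) (face : 'I_q -> 'I_N)
         (W E : 'I_q -> set 'rV[R]_(m + m.+1))
         (g : 'I_q -> 'rV[R]_(m + m.+1) -> Cn),
    [/\ forall t, boundary_parametrization c (Om (face t)) (W t) (g t),
        forall t, [/\ borel (E t), E t `<=` W t
          & forall x, E t x -> bdry (total_domain Om) (inv_coord c (g t x))],
        trivIset setT (fun t => g t @` E t),
        forall p,
          chart_dom c p -> bdry (total_domain Om) p -> w (coord c p) != 0 ->
          exists t, (g t @` E t) (coord c p)
      & I = \sum_t integral_rV_C (E t) (pullback_real (g t) w)].

(* gamma is the boundary current bc f.  For small e the integral exists and is
   unique: the support of psi is compact and v is outward, so that f_e is
   defined near the part of the boundary lying in the support of psi. *)
Definition boundary_current N (Om : 'I_N -> set M) (f : M -> C)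
    (gamma : nn1_form -> C) : Prop :=
  is_current gamma /\
  forall (c : chartM) (psi : nn1_form) (h : Cn -> Cn) (v : Cn),
    coordinate_chart c -> test_form psi -> form_support psi `<=` chart_dom c ->
    coefficients psi c h ->
    (forall j p, chart_dom c p -> bdry (Om j) p -> outward c (Om j) p v) ->
    forall I : R -> C,
      (\forall e \near (0 : R)^'+,
         boundary_integral c Om
           (fun z => f (inv_coord c (z - e%:C *: v)) *: h z) (I e)) ->
      (I e : C) @[e --> (0 : R)^'+] --> (gamma psi : C).

End Currents.

(* Main.v *)
Require Import Defs.
From mathcomp Require Import all_boot all_order all_algebra.
From mathcomp Require Import complex ring lra.
From mathcomp Require Import all_classical all_reals all_analysis.

(** The counterexample lives in dimension one.  Let Omega be the triangle
    [x < 0, y < 0, x + y > -4] in the complex plane, an intersection of three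
    half-planes, and f (z) = z^-4, whose pole is the right-angled corner 0.
    The corner of two sides would have to be a CR manifold of CR-dimension
    1 - 2 < 0, so the corners are not generic; and |f (z)| = |z|^-4 is at most
    dist (z, bd Omega)^-4 because 0 is a boundary point.

    Along a smooth piece of boundary, integration by parts tames a pole of any
    order.  At a corner the integrations by parts leave terms at the common end
    point of the two sides; these come with different factors and do not
    cancel.  To isolate one side, take the test form
      psi = chi (x) y chi (y) dz
    with chi a smooth cutoff supported in [-1, 1].  It vanishes on the
    horizontal side, so that the boundary integral reduces to the vertical
    one, parametrized near the support by z = i t (-2 < t < 0), in the
    positive direction.
    With v = 1 + i, which points out of both sides at 0,
      int f_eps psi = i int_{-2}^0 (i t - eps v)^-4 chi (0) t chi (t) dt,
    and the real part of this is the integral of the nonnegative kernel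
      4 eps (eps - t) (2 eps t - t^2) / (eps^2 + (t - eps)^2)^4
        * chi (0) t chi (t)
    ([Re_shifted_form], [kernel_ge0]).  For t between -2 eps and -eps every
    factor is comparable to a power of eps and the kernel is at least
    c / eps^3 ([kernel_lower]).  Hence the real part is at least c / eps^2
    ([Re_edge_integral_lower]), and no limit exists, whatever the current.

    The form psi is supported in the square |x| < 2, |y| < 2, which avoids the
    third side; so v is outward along every side that meets this coordinate
    neighbourhood. *)

Set Implicit Arguments.
Unset Strict Implicit.
Unset Printing Implicit Defensive.

Import Order.TTheory GRing.Theory Num.Theory.
Import numFieldNormedType.Exports.

Local Open Scope classical_set_scope.
Local Open Scope ring_scope.
Local Open Scope complex_scope.

(** * The topology of the complex line in real coordinates *)

Section ComplexLine.
Context {R : realType}.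
Local Notation C := R[i].
Local Notation C1 := 'rV[C]_1.

Definition X (z : C1) : R := complex.Re (z 0 0).
Definition Y (z : C1) : R := complex.Im (z 0 0).
Definition pt (x y : R) : C1 := const_mx (x +i* y).
(** The real number underlying the norm, which takes its values in [R[i]]. *)
Definition eucl (p q : C1) : R := complex.Re `|p - q|.

Lemma X_pt x y : X (pt x y) = x. Proof. by rewrite /X mxE. Qed.
Lemma Y_pt x y : Y (pt x y) = y. Proof. by rewrite /Y mxE. Qed.

Lemma ptK z : pt (X z) (Y z) = z.
Proof. by apply/rowP => j; rewrite !ord1 mxE /X /Y; case: (z 0 0). Qed.

Lemma XB p q : X (p - q) = X p - X q.
Proof. by rewrite /X !mxE; case: (p 0 0) (q 0 0) => a b []. Qed.

Lemma YB p q : Y (p - q) = Y p - Y q.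
Proof. by rewrite /Y !mxE; case: (p 0 0) (q 0 0) => a b []. Qed.

Lemma norm_C1 (z : C1) : `|z| = (Num.sqrt (X z ^+ 2 + Y z ^+ 2))%:C.
Proof.
rewrite /X /Y -normc_def.
have [z0|/mx_norm_neq0 [[i j] zE]] := eqVneq (mx_norm z) 0.
  by rewrite (mx_norm_eq0 z0) mxE !normr0.
by move: zE; rewrite /= !ord1.
Qed.

Lemma euclE p q : eucl p q = Num.sqrt ((X p - X q) ^+ 2 + (Y p - Y q) ^+ 2).
Proof. by rewrite /eucl norm_C1 XB YB. Qed.

Lemma norm_eucl p q : `|p - q| = (eucl p q)%:C.
Proof. by rewrite /eucl norm_C1. Qed.

Lemma eucl_geX p q : `|X p - X q| <= eucl p q.
Proof. by rewrite euclE -sqrtr_sqr ler_sqrt ?addr_ge0 ?sqr_ge0// lerDl sqr_ge0. Qed.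

Lemma eucl_geY p q : `|Y p - Y q| <= eucl p q.
Proof. by rewrite euclE -sqrtr_sqr ler_sqrt ?addr_ge0 ?sqr_ge0// lerDr sqr_ge0. Qed.

Lemma eucl_le p q : eucl p q <= `|X p - X q| + `|Y p - Y q|.
Proof.
have h0 : 0 <= `|X p - X q| + `|Y p - Y q| by rewrite addr_ge0.
rewrite euclE -[leRHS]ger0_norm// -sqrtr_sqr ler_sqrt ?sqr_ge0//.
set a := X p - X q; set b := Y p - Y q.
rewrite (sqrrD `|a|) !real_normK ?num_real// lerD2r lerDl mulrn_wge0//.
Qed.

Lemma nbhs_eucl (p : C1) (A : set C1) :
  nbhs p A <-> exists2 e : R, 0 < e & forall q, eucl p q < e -> A q.
Proof.
split.
  move=> /(@nbhs_normP _ _ p A) [e /= e0 h].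
  move: e0 h; rewrite ltcE /= => /andP[/eqP ie re] h.
  exists (complex.Re e) => // q pq; apply: h => /=.
  by rewrite norm_eucl ltcE /= ie eqxx.
move=> [e e0 h]; apply/(@nbhs_normP _ _ p A); exists (e%:C) => /=; first by rewrite ltcR.
by move=> q /=; rewrite norm_eucl ltcR; exact: h.
Qed.

(** The boxes form a basis of neighbourhoods: this reduces every topological
    question about the complex line to two real coordinates. *)
Lemma nbhs_box (p : C1) (A : set C1) :
  nbhs p A <-> exists2 e : R, 0 < e &
    forall q, `|X p - X q| < e -> `|Y p - Y q| < e -> A q.
Proof.
rewrite nbhs_eucl; split => -[e e0 h].
  exists (e / 2); first by rewrite divr_gt0.
  move=> q hx hy; apply: h; apply: le_lt_trans (eucl_le _ _) _.
  by rewrite [e]splitr ltrD.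
exists e => // q pq; apply: h.
  exact: le_lt_trans (eucl_geX _ _) pq.
exact: le_lt_trans (eucl_geY _ _) pq.
Qed.

Lemma continuous_X : continuous X.
Proof.
move=> p A /nbhs_ballP [e /= e0 h].
by apply/nbhs_box; exists e => // q hx _; exact: h.
Qed.

Lemma continuous_Y : continuous Y.
Proof.
move=> p A /nbhs_ballP [e /= e0 h].
by apply/nbhs_box; exists e => // q _ hx; exact: h.
Qed.

Lemma cvg_pt {T : Type} (F : set_system T) {FF : Filter F} (f g : T -> R) a b :
  f @ F --> a -> g @ F --> b -> pt (f x) (g x) @[x --> F] --> pt a b.
Proof.
move=> fa gb A /nbhs_box [e e0 h].
have /cvgrPdist_lt /(_ e e0) fa' := fa.
have /cvgrPdist_lt /(_ e e0) gb' := gb.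
suff: \forall x \near F, A (pt (f x) (g x)) by [].
near=> x; apply: h; rewrite !(X_pt, Y_pt); near: x; [exact: fa'|exact: gb'].
Unshelve. all: by end_near. Qed.

(** The open boxes with rational corners are a countable basis. *)
Lemma second_countable_C1 : @second_countable C1.
Proof.
pose box (r : (rat * rat) * (rat * rat)) : set C1 :=
  [set q | [/\ ratr r.1.1 < X q, X q < ratr r.1.2, ratr r.2.1 < Y q
             & Y q < ratr r.2.2]].
exists (range box).
  exact: sub_countable (card_image_le _ _) (countableP _).
split.
  move=> _ [[[a b] [c d]] _ <-].
  rewrite (_ : box _ = X @^-1` `]ratr a, ratr b[ `&`
                       Y @^-1` `]ratr c, ratr d[); last first.
    apply/seteqP; split => q /=; rewrite !in_itv/=.
      by move=> [h1 h2 h3 h4]; rewrite h1 h2 h3 h4.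
    by move=> [/andP[? ?] /andP[? ?]].
  apply: openI; apply: open_comp => //; try exact: interval_open.
    by move=> q _; exact: continuous_X.
  by move=> q _; exact: continuous_Y.
move=> p A /nbhs_box [e e0 h].
have bracket (t : R) : exists r : rat * rat,
    [/\ t - e < ratr r.1, ratr r.1 < t, t < ratr r.2 & ratr r.2 < t + e].
  have /rat_in_itvoo [r1] : t - e < t by rewrite gtrBl.
  have /rat_in_itvoo [r2] : t < t + e by rewrite ltrDl.
  rewrite !in_itv /= => /andP[? ?] /andP[? ?].
  by exists (r1, r2).
have [rx [? ? ? ?]] := bracket (X p).
have [ry [? ? ? ?]] := bracket (Y p).
exists (box (rx, ry)); first by split; [exists (rx, ry)|].
move=> q [/= ? ? ? ?]; apply: h; rewrite ltr_norml; apply/andP; split; lra.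
Qed.

End ComplexLine.

(** * Smooth functions of several real variables *)

Section SmoothFunctions.
Context {R : realType}.

(** Smoothness by coinduction: a class of continuous functions stable under
    all partial derivatives consists of smooth functions. *)
Lemma smooth_on_closed k (P : ('rV[R]_k -> R) -> Prop) (A : set 'rV[R]_k) g :
  (forall f, P f -> continuous f /\
     forall a, (forall x, derivable f x (delta_mx 0 a)) /\ P (partial a f)) ->
  P g -> smooth_on A g.
Proof.
move=> hP Pg s x _.
have Ps : P (iter_partial s g).
  by elim: s => //= a s /hP [_ /(_ a) []].
have [cs ds] := hP _ Ps; split; first exact: cs.
by move=> a; apply: (ds a).1.
Qed.

(** A partial derivative only sees the restriction of the function to a
    line, here given as a function [phi] of the moving coordinate. *)
Lemma partial_line k (a : 'I_k) (f : 'rV[R]_k -> R) x (phi : R -> R) :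
  (forall h, f (h *: delta_mx 0 a + x) = phi (h + x 0 a)) ->
  derivable phi (x 0 a) 1 ->
  derivable f x (delta_mx 0 a) /\ partial a f x = derive1 phi (x 0 a).
Proof.
move=> fphi dphi.
have E : (fun h => h^-1 *: ((f \o shift x) (h *: delta_mx 0 a) - f x)) =
         (fun h => h^-1 *: ((phi \o shift (x 0 a)) (h *: (1 : R)) - phi (x 0 a))).
  apply/funext => h /=; rewrite fphi -[in f x](add0r x).
  by rewrite -(scale0r (delta_mx 0 a : 'rV[R]_k)) fphi add0r [h *: 1]mulr1.
split; first by rewrite /derivable E.
by rewrite /partial derive1E /derive E.
Qed.

Definition affine k (f : 'rV[R]_k -> R) :=
  exists c (u : 'I_k -> R), forall x, f x = c + \sum_j u j * x 0 j.

Lemma affine_partial k (f : 'rV[R]_k -> R) c u :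
  (forall x, f x = c + \sum_j u j * x 0 j) ->
  forall a x, derivable f x (delta_mx 0 a) /\ partial a f x = u a.
Proof.
move=> fE a x.
have lin h : f (h *: delta_mx 0 a + x) = (f x - u a * x 0 a) + u a * (h + x 0 a).
  rewrite !fE (bigD1 a)//= [in RHS](bigD1 a)//= !mxE !eqxx/= mulr1.
  rewrite (eq_bigr (fun j => u j * x 0 j)); first by lra.
  by move=> j /negbTE ja; rewrite !mxE ja andbF mulr0 add0r.
have dphi : is_derive (x 0 a) 1 (fun t => (f x - u a * x 0 a) + u a * t) (u a).
  apply: is_derive_eq; rewrite ?add0r.
  by rewrite mul1r /GRing.scale/= mulr1.
have [d ->] := partial_line lin (@ex_derive _ _ _ _ _ _ _ dphi).
by split=> //; rewrite derive1E derive_val.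
Qed.

Lemma affine_smooth k (f : 'rV[R]_k -> R) A : affine f -> smooth_on A f.
Proof.
apply: (@smooth_on_closed _ (@affine k)) => {}f [c [u fE]]; split.
  have -> : f = fun x => c + \sum_j u j * x 0 j by apply/funext => x; rewrite fE.
  move=> x; apply: continuousD; first exact: cst_continuous.
  apply: (@continuous_big _ _ _ _ _ add_continuous) => j _ {}x.
  by apply: continuousM; [exact: cst_continuous|exact: coord_continuous].
move=> a; split=> [x|]; first exact: (affine_partial fE a x).1.
exists (u a), (fun=> 0) => x.
by rewrite (affine_partial fE a x).2 big1 ?addr0// => j _; rewrite mul0r.
Qed.

Definition smooth1 (p : R -> R) := forall n x, derivable (derive1n n p) x 1.

Lemma smooth1_derive p : smooth1 p -> smooth1 (derive1 p).
Proof. by move=> sp n; rewrite -derive1Sn; exact: sp n.+1. Qed.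

Definition tensor (p q : R -> R) (x : 'rV[R]_(1 + 1)) : R :=
  p (x 0 (lshift 1 0)) * q (x 0 (rshift 1 0)).

(** Products of functions of separate variables are stable under partial
    derivatives, which act on one factor at a time. *)
Lemma tensor_smooth p q A : smooth1 p -> smooth1 q -> smooth_on A (tensor p q).
Proof.
move=> sp sq.
apply: (@smooth_on_closed _ (fun f =>
  exists p q, [/\ smooth1 p, smooth1 q & f = tensor p q])); last by exists p, q.
move=> {p q sp sq} _ [p [q [sp sq ->]]].
have cp : continuous p.
  by move=> t; apply/differentiable_continuous/derivable1_diffP; exact: (sp 0%N).
have cq : continuous q.
  by move=> t; apply/differentiable_continuous/derivable1_diffP; exact: (sq 0%N).
split.
  move=> x; apply: continuousM.
    by apply: continuous_comp; [exact: coord_continuous|exact: cp].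
  by apply: continuous_comp; [exact: coord_continuous|exact: cq].
move=> a.
have [j ->|j ->] := split_ordP a; rewrite !ord1 {j}.
  have H x : derivable (tensor p q) x (delta_mx 0 (lshift 1 0)) /\
      partial (lshift 1 0) (tensor p q) x = tensor (derive1 p) q x.
    have lin h : tensor p q (h *: delta_mx 0 (lshift 1 0) + x) =
        (fun t => q (x 0 (rshift 1 0)) *: p t) (h + x 0 (lshift 1 0)).
      by rewrite /tensor !mxE /= mulr1 mulr0 add0r mulrC.
    have dp := sp 0%N (x 0 (lshift 1 0)).
    have [d ->] := partial_line lin (derivableZ dp).
    by split => //; rewrite derive1E deriveZ// -derive1E /tensor [LHS]mulrC.
  split; first by move=> x; exact: (H x).1.
  exists (derive1 p), q; split => //; first exact: smooth1_derive.
  by apply/funext => x; exact: (H x).2.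
have H x : derivable (tensor p q) x (delta_mx 0 (rshift 1 0)) /\
    partial (rshift 1 0) (tensor p q) x = tensor p (derive1 q) x.
  have lin h : tensor p q (h *: delta_mx 0 (rshift 1 0) + x) =
      (fun t => p (x 0 (lshift 1 0)) *: q t) (h + x 0 (rshift 1 0)).
    by rewrite /tensor !mxE /= mulr1 mulr0 add0r.
  have dq := sq 0%N (x 0 (rshift 1 0)).
  have [d ->] := partial_line lin (derivableZ dq).
  by split => //; rewrite derive1E deriveZ// -derive1E.
split; first by move=> x; exact: (H x).1.
exists p, (derive1 q); split => //; first exact: smooth1_derive.
by apply/funext => x; exact: (H x).2.
Qed.

End SmoothFunctions.

(** * A smooth cutoff function *)

Section Bump.
Context {R : realType}.
Implicit Types (p q : {poly R}) (f g : R -> R).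

Lemma smooth1_closed (P : (R -> R) -> Prop) f :
  (forall f, P f -> (forall x, derivable f x 1) /\ P (derive1 f)) ->
  P f -> smooth1 f.
Proof.
move=> hP Pf n x; have Pn : P (derive1n n f).
  by elim: n => [|n /hP []]; rewrite ?derive1n0 ?derive1nS.
exact: (hP _ Pn).1.
Qed.

(** Finite orders of differentiability, where the Leibniz rule can be proved
    by induction on the order. *)
Fixpoint differentiable_n n f : Prop :=
  if n is m.+1 then (forall x, derivable f x 1) /\ differentiable_n m (derive1 f)
  else True.

Lemma smooth1P f : smooth1 f <-> forall n, differentiable_n n f.
Proof.
split=> [sf n|].
  elim: n f sf => //= n IH f sf; split; first exact: (sf 0%N).
  by apply: IH; exact: smooth1_derive.
apply: (@smooth1_closed (fun f => forall n, differentiable_n n f)) => {}f h.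
split; first exact: (h 1%N).1.
by move=> n; exact: (h n.+1).2.
Qed.

Lemma differentiable_nW n f : differentiable_n n.+1 f -> differentiable_n n f.
Proof. by elim: n f => //= n IH f [df /IH]. Qed.

Lemma differentiable_nD n f g :
  differentiable_n n f -> differentiable_n n g -> differentiable_n n (f \+ g).
Proof.
elim: n f g => //= n IH f g [df nf] [dg ng]; split.
  by move=> x; exact: derivableD.
rewrite (_ : derive1 _ = derive1 f \+ derive1 g); first exact: IH.
by apply/funext => x; rewrite !derive1E deriveD//= !derive1E.
Qed.

Lemma differentiable_nM n f g :
  differentiable_n n f -> differentiable_n n g -> differentiable_n n (f \* g).
Proof.
elim: n f g => // n IH f g nf ng.
have nf' := differentiable_nW nf; have ng' := differentiable_nW ng.
case: nf ng => [df nf] [dg ng]; split; first by move=> x; exact: derivableM.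
rewrite (_ : derive1 _ = (f \* derive1 g) \+ (g \* derive1 f)).
  by apply: differentiable_nD; apply: IH.
by apply/funext => x; rewrite !derive1E deriveM//= !derive1E.
Qed.

Lemma smooth1M f g : smooth1 f -> smooth1 g -> smooth1 (f \* g).
Proof.
by move=> /smooth1P sf /smooth1P sg; apply/smooth1P => n; exact: differentiable_nM.
Qed.

Lemma smooth1_id : smooth1 (id : R -> R).
Proof.
apply: (@smooth1_closed (fun f => exists a b, f = fun x => a + b * x)); last first.
  by exists 0, 1; apply/funext => x; rewrite add0r mul1r.
move=> _ [a [b ->]].
have d (x : R) : is_derive x (1 : R) (fun x => a + b * x) b.
  by apply: is_derive_eq; rewrite add0r mul1r /GRing.scale/= mulr1.
split=> [x|]; first exact: (@ex_derive _ _ _ _ _ _ _ (d x)).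
exists b, 0; apply/funext => x.
by rewrite derive1E (@derive_val _ _ _ _ _ _ _ (d x)) mul0r addr0.
Qed.

Lemma smooth1_affine f (c s : R) : smooth1 f -> smooth1 (fun x => f (c + s * x)).
Proof.
move=> sf; apply: (@smooth1_closed (fun g => exists k f, smooth1 f /\
   g = fun x => k * f (c + s * x))); last first.
  by exists 1, f; split => //; apply/funext => x; rewrite mul1r.
move=> {f sf} _ [k [f [sf ->]]].
have d (x : R) : is_derive x (1 : R) (fun x => k * f (c + s * x))
    (k * s * derive1 f (c + s * x)).
  have df : is_derive (c + s * x) 1 f (derive1 f (c + s * x)).
    by rewrite derive1E; apply/derivableP; exact: (sf 0%N).
  have dl : is_derive x (1 : R) (fun x => c + s * x) s.
    by apply: is_derive_eq; rewrite add0r mul1r /GRing.scale/= mulr1.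
  have dc : is_derive x (1 : R) (f \o (fun x => c + s * x)) (s * derive1 f (c + s * x)).
    by rewrite mulrC; exact: is_derive1_comp.
  have := is_deriveZ k dc.
  by rewrite /GRing.scale /= mulrA.
split=> [x|]; first exact: (@ex_derive _ _ _ _ _ _ _ (d x)).
exists (k * s), (derive1 f); split; first exact: smooth1_derive.
by apply/funext => x; rewrite derive1E (@derive_val _ _ _ _ _ _ _ (d x)).
Qed.

(** The function p (1/x) exp (-1/x), extended by zero to x <= 0.  The
    polynomial factor makes the family stable under derivation. *)
Definition flat p (x : R) : R :=
  if 0 < x then p.[x^-1] * expR (- x^-1) else 0.

(** The exponential dominates its Taylor term of degree [n.+1], one more than
    the degree of the power; the extra factor 1/x gives the decay. *)
Lemma expR_decay n (x : R) : 0 < x -> x^-1 ^+ n * expR (- x^-1) <= n.+1`!%:R * x.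
Proof.
move=> x0; rewrite expRN -ler_pdivlMr ?invr_gt0 ?expR_gt0// invrK.
have u0 : 0 < x^-1 by rewrite invr_gt0.
have := @expR_ge1Dxn R x^-1 n (ltW u0) => h.
have {}h : x^-1 ^+ n.+1 / n.+1`!%:R <= expR x^-1.
  by apply: le_trans h; rewrite lerDr.
rewrite -mulrA -ler_pdivrMl ?ltr0n ?fact_gt0// mulrC.
rewrite exprS in h.
have := ler_wpM2l (ltW x0) h.
by rewrite -!mulrA mulVKf ?gt_eqF// => h'; rewrite mulrA in h'.
Qed.

Lemma flat_le p : exists2 K : R, 0 <= K & forall x, `|flat p x| <= K * `|x|.
Proof.
exists (\sum_(i < size p) `|p`_i| * i.+1`!%:R).
  by apply: sumr_ge0 => i _; rewrite mulr_ge0.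
move=> x; rewrite /flat; case: ifPn => [x0|_]; last first.
  by rewrite normr0 mulr_ge0// sumr_ge0// => i _; rewrite mulr_ge0.
rewrite horner_coef mulr_suml mulr_suml; apply: le_trans (ler_norm_sum _ _ _) _.
apply: ler_sum => i _; rewrite -!mulrA normrM ler_wpM2l//.
rewrite ger0_norm ?mulr_ge0 ?exprn_ge0 ?expR_ge0 ?invr_ge0 ?(ltW x0)//.
by rewrite (gtr0_norm x0); exact: expR_decay.
Qed.

Lemma near_is_derive1 f g (x d : R) : (\forall t \near x, f t = g t) ->
  is_derive x (1 : R) f d -> is_derive x (1 : R) g d.
Proof. exact: near_eq_is_derive. Qed.

(** For x > 0 this is the chain rule.  At 0 the difference quotient of
    [flat p] is [flat ('X * p)], which tends to 0 by [flat_le]. *)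
Lemma is_derive_flat p (x : R) :
  is_derive x (1 : R) (flat p) (flat ('X^2 * (p - p^`())) x).
Proof.
have [x0|x0|->] := ltgtP x 0.
- rewrite [X in is_derive _ _ _ X]/flat ltNge (ltW x0)/=.
  apply: (near_is_derive1 _ (is_derive_cst (0 : R) x (1 : R))).
  near=> t; rewrite /flat ifF//; apply/negbTE; rewrite -leNgt.
  by near: t; apply: filterS (lt_nbhsl x0) => t /ltW.
- apply: (@near_is_derive1 (fun t => p.[t^-1] * expR (- t^-1))).
    by near=> t; rewrite /flat ifT//; near: t; exact: lt_nbhsr.
  have dV : is_derive x (1 : R) (fun t : R => t^-1) (- x^-2).
    have := @is_deriveV _ id x 1 1 (lt0r_neq0 x0) (is_derive_id _ _).
    by rewrite /GRing.scale/= mulr1.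
  have dp : is_derive x (1 : R) (horner p \o (fun t : R => t^-1))
      (p^`().[x^-1] * - x^-2) by exact: is_derive1_comp.
  have dN : is_derive x (1 : R) (fun t : R => - t^-1) (x^-2).
    by have := is_deriveN dV; rewrite opprK.
  have de : is_derive x (1 : R) (expR \o (fun t : R => - t^-1))
      (expR (- x^-1) * x^-2) by exact: is_derive1_comp.
  have := is_deriveM dp de; rewrite /flat x0 /GRing.scale/=.
  rewrite hornerM hornerXn hornerD hornerN -exprVn => h.
  by apply: is_derive_eq h _; ring.
rewrite [X in is_derive _ _ _ X]/flat ltxx.
have [K K0 hK] := flat_le ('X * p).
have flatX h : flat p h = h * flat ('X * p) h.
  rewrite /flat; case: ifPn => h0; last by rewrite mulr0.
  by rewrite hornerM hornerX !mulrA divff ?mul1r// gt_eqF.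
have L : h^-1 *: ((flat p \o shift 0) (h *: (1 : R)) - flat p 0) @[h --> 0^'] --> (0 : R).
  apply/cvgrPdist_le => e e0; near=> h.
  have h0 : h != 0 by near: h; exact: nbhs_dnbhs_neq.
  rewrite /= addr0 [h *: 1]mulr1 [flat p 0]/flat ltxx !subr0 flatX.
  rewrite [_ *: _]mulKf// sub0r normrN; apply: le_trans (hK h) _.
  apply: (@le_trans _ _ ((K + 1) * `|h|)); first by rewrite ler_wpM2r// lerDl.
  rewrite mulrC -ler_pdivlMr ?ltr_wpDl//; near: h.
  by apply: dnbhs0_le; rewrite divr_gt0// ltr_wpDl.
have dv : derivable (flat p) 0 1 by apply/cvg_ex; exists 0.
by split => //; exact: cvg_lim.
Unshelve. all: by end_near. Qed.

Lemma smooth1_flat p : smooth1 (flat p).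
Proof.
apply: (@smooth1_closed (fun f => exists p, f = flat p)); last by exists p.
move=> {p} _ [p ->]; have d := is_derive_flat p.
split=> [x|]; first exact: (@ex_derive _ _ _ _ _ _ _ (d x)).
exists ('X^2 * (p - p^`())); apply/funext => x.
by rewrite derive1E (@derive_val _ _ _ _ _ _ _ (d x)).
Qed.

(** Positive exactly on ]-1, 1[; the coefficients [-1] and [1] are kept
    explicit to match [smooth1_affine]. *)
Definition cutoff (x : R) : R := flat 1 (1 + (-1) * x) * flat 1 (1 + 1 * x).

Lemma smooth1_cutoff : smooth1 cutoff.
Proof. by apply: smooth1M; apply: smooth1_affine; exact: smooth1_flat. Qed.

Lemma cutoff_ge0 x : 0 <= cutoff x.
Proof.
by rewrite /cutoff /flat !hornerC !mul1r mulr_ge0//; case: ifP => // _; exact: expR_ge0.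
Qed.

Lemma cutoff_eq0 x : 1 <= `|x| -> cutoff x = 0.
Proof.
rewrite /cutoff /flat mulN1r mul1r ler_normr => /orP[] h.
  by rewrite ltNge (_ : 1 - x <= 0) ?mul0r//=; lra.
by rewrite [X in _ * X]ifF ?mulr0//; apply/negbTE; rewrite -leNgt; lra.
Qed.

End Bump.

(** * Convex sets and half-planes *)

Section Geometry.
Context {R : realType}.
Local Notation C := R[i].
Local Notation C1 := 'rV[C]_1.

Lemma continuous_pt_line (a b c d : R) :
  continuous (fun t : R => pt (a + b * t) (c + d * t)).
Proof.
move=> t; apply: cvg_pt.
  by apply: continuousD; [exact: cst_continuous|
    apply: continuousM; [exact: cst_continuous|exact: cvg_id]].
by apply: continuousD; [exact: cst_continuous|
    apply: continuousM; [exact: cst_continuous|exact: cvg_id]].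
Qed.

Definition convex_C1 (A : set C1) := forall p q t, A p -> A q -> 0 <= t <= 1 ->
  A (pt (X p + (X q - X p) * t) (Y p + (Y q - Y p) * t)).

(** A convex set is the union of the segments issued from one of its
    points. *)
Lemma convex_connected (A : set C1) : convex_C1 A -> connected A.
Proof.
move=> cA; have [->|/set0P[p Ap]] := eqVneq A set0; first exact: connected0.
pose s (q : C1) : R -> C1 :=
  fun t => pt (X p + (X q - X p) * t) (Y p + (Y q - Y p) * t).
have -> : A = \bigcup_(q in A) (s q @` `[0, 1]%classic).
  apply/seteqP; split => [q Aq|_ [q Aq [t /= + <-]]].
    exists q => //; exists 1; rewrite /= ?in_itv/= ?ler01 ?lexx//.
    by rewrite /s !mulr1 ![_ + (_ - _)]addrC !subrK ptK.
  by rewrite in_itv/=; exact: cA.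
apply: bigcup_connected => [|q Aq].
  exists p => q Aq; exists 0; rewrite /= ?in_itv/= ?ler01 ?lexx//.
  by rewrite /s !mulr0 !addr0 ptK.
apply: connected_continuous_connected; first exact: segment_connected.
by apply: continuous_subspaceT; exact: continuous_pt_line.
Qed.

(** A point is adherent to a set as soon as some half-line issued from it
    enters the set at once. *)
Lemma closure_line (A : set C1) (p : C1) (a b : R) :
  (\forall t \near (0 : R)^'+, A (pt (X p + a * t) (Y p + b * t))) -> closure A p.
Proof.
move=> h B nB.
have : \forall t \near (0 : R)^'+, B (pt (X p + a * t) (Y p + b * t)).
  have := cvg_at_right_filter (@continuous_pt_line (X p) a (Y p) b 0).
  by rewrite !mulr0 !addr0 ptK; apply.
move=> hB; have [t [? ?]] := filter_ex (filterI h hB).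
by eexists; split; eassumption.
Qed.

Definition halfplane (a b c : R) : set C1 := [set z | a * X z + b * Y z < c].

Lemma continuous_linear_form (a b : R) : continuous (fun z : C1 => a * X z + b * Y z).
Proof.
move=> z; apply: (@cvgD _ _ _ (nbhs z) (nbhs_filter z)).
  apply: (@cvgM _ _ (nbhs z) (nbhs_filter z)); first exact: cvg_cst.
  exact: continuous_X.
apply: (@cvgM _ _ (nbhs z) (nbhs_filter z)); first exact: cvg_cst.
exact: continuous_Y.
Qed.

Lemma open_halfplane a b c : open (halfplane a b c).
Proof.
apply: (@open_comp _ _ (fun z : C1 => a * X z + b * Y z) [set t | t < c]).
  by move=> z _; exact: continuous_linear_form.
exact: open_lt.
Qed.

Lemma closure_halfplane a b c z : closure (halfplane a b c) z ->
  a * X z + b * Y z <= c.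
Proof.
have cl : closed [set z : C1 | a * X z + b * Y z <= c].
  apply: (@closed_comp _ _ (fun z : C1 => a * X z + b * Y z) [set t | t <= c]).
    by move=> ? _; exact: continuous_linear_form.
  exact: closed_le.
by move=> h; apply: cl; apply: closureS h => w; exact: ltW.
Qed.

Lemma convex_halfplane a b c : convex_C1 (halfplane a b c).
Proof.
move=> p q t; rewrite /halfplane /= !X_pt !Y_pt => hp hq /andP[t0 t1].
have -> : a * (X p + (X q - X p) * t) + b * (Y p + (Y q - Y p) * t) =
   (1 - t) * (a * X p + b * Y p) + t * (a * X q + b * Y q) by ring.
have -> : c = (1 - t) * c + t * c by ring.
(* At t = 0 only the first of the two strict inequalities survives. *)
have [->|tn0] := eqVneq t 0; first by rewrite subr0 !mul1r !mul0r !addr0.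
rewrite ler_ltD ?ler_wpM2l ?subr_ge0 ?(ltW hp)// ltr_pM2l//.
by rewrite lt0r tn0.
Qed.

(** The points of the bounding line are reached from inside along the
    normal, in the direction of [- (a, b)]. *)
Lemma halfplane_boundary a b c z : (a != 0) || (b != 0) ->
  closure (halfplane a b c) z /\ ~ halfplane a b c z <-> a * X z + b * Y z = c.
Proof.
move=> ab; split=> [[/closure_halfplane zc /negP]|zc].
  by rewrite -leNgt => cz; apply/eqP; rewrite eq_le zc.
split; last by rewrite /halfplane /= zc ltxx.
apply: (@closure_line _ _ (- a) (- b)); near=> t.
rewrite /halfplane /= X_pt Y_pt.
have -> : a * (X z + - a * t) + b * (Y z + - b * t) =
   (a * X z + b * Y z) - (a ^+ 2 + b ^+ 2) * t by ring.
rewrite zc gtrBl mulr_gt0// lt0r addr_ge0 ?sqr_ge0// andbT.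
by rewrite paddr_eq0 ?sqr_ge0// !sqrf_eq0 negb_and.
Unshelve. all: by end_near. Qed.

Lemma compact_box (r : R) : compact [set z : C1 | `|X z| <= r /\ `|Y z| <= r].
Proof.
rewrite (_ : [set _ | _] =
    (fun xy : R * R => pt xy.1 xy.2) @` (`[- r, r] `*` `[- r, r])%classic).
  apply: continuous_compact; last first.
    by apply: compact_setX; exact: segment_compact.
  apply: continuous_subspaceT => -[x y].
  by apply: cvg_pt; [exact: cvg_fst|exact: cvg_snd].
apply/seteqP; split=> [z [/= hx hy]|_ [[x y] [/= hx hy] <-]].
  by exists (X z, Y z); rewrite /= ?ptK// !in_itv/= -!ler_norml.
by rewrite X_pt Y_pt; move: hx hy; rewrite !in_itv/= -!ler_norml.
Qed.

Lemma compact_closure_box (A : set C1) (r : R) :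
  (forall z, A z -> `|X z| <= r /\ `|Y z| <= r) -> compact (closure A) /\
  forall z, closure A z -> `|X z| <= r /\ `|Y z| <= r.
Proof.
move=> hA.
have cb : closed [set z : C1 | `|X z| <= r /\ `|Y z| <= r].
  by apply: compact_closed (@compact_box r); exact: norm_hausdorff.
have sub z : closure A z -> `|X z| <= r /\ `|Y z| <= r.
  by move=> cz; apply: cb; apply: closureS cz => w; exact: hA.
split=> //; apply: subclosed_compact (@compact_box r) _ => //.
exact: closed_closure.
Qed.

End Geometry.

(** * The plane as a manifold, and the triangle *)

Section Plane.
Context {R : realType}.
Local Notation C := R[i].
Local Notation C1 := 'rV[C]_1.

(** All the charts in use are restrictions of the identity; transition maps
    are then the identity too. *)
Definition id_chart (A : set C1) : chart R C1 1 := Chart A id id.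

Lemma id_chart_img A : chart_img (id_chart A) = A.
Proof. exact: image_id. Qed.

Lemma is_chart_id A : open A -> is_chart (id_chart A).
Proof. by move=> oA; split=> //; rewrite ?id_chart_img// => *; exact: cvg_id. Qed.

Lemma differentiable_idC1 (z : C1) : differentiable (id : C1 -> C1) z.
Proof. exact: (@ex_diff _ _ _ _ _ _ _ (is_diff_id z)). Qed.

Lemma holo_compatible_id A B : holo_compatible (id_chart A) (id_chart B).
Proof. by split=> z _; exact: differentiable_idC1. Qed.

Definition plane : complexManifold R 1 :=
  @ComplexManifold R 1 C1 unit (fun=> id_chart setT)
    (@norm_hausdorff _ C1) second_countable_C1
    (fun=> is_chart_id openT) (fun p => ex_intro _ tt I)
    (fun _ _ => holo_compatible_id setT setT).

Lemma coordinate_chart_id (A : set C1) :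
  open A -> @coordinate_chart _ _ plane (id_chart A).
Proof. by move=> oA; split=> [|i]; [exact: is_chart_id|exact: holo_compatible_id]. Qed.

(** The global defining function of [halfplane a b c]. *)
Definition linear_fun (a b c : R) (z : C1) : R := a * X z + b * Y z - c.

Lemma X_of_real (x : 'rV[R]_(1 + 1)) : X (of_real x) = x 0 (lshift 1 0).
Proof. by rewrite /X mxE. Qed.

Lemma Y_of_real (x : 'rV[R]_(1 + 1)) : Y (of_real x) = x 0 (rshift 1 0).
Proof. by rewrite /Y mxE. Qed.

Lemma linear_fun_affine a b c (x : 'rV[R]_(1 + 1)) :
  real_fun (linear_fun a b c) x =
    - c + \sum_j (row_mx a%:M b%:M : 'rV_(1 + 1)) 0 j * x 0 j.
Proof.
rewrite /real_fun /linear_fun X_of_real Y_of_real big_split_ord !big_ord1.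
by rewrite row_mxEl row_mxEr !mxE eqxx addrC.
Qed.

Lemma gradient_linear a b c z :
  gradient (linear_fun a b c) z = row_mx a%:M b%:M.
Proof.
by apply/rowP => j; rewrite mxE (affine_partial (linear_fun_affine a b c) _ _).2.
Qed.

Lemma defining_halfplane (U : set C1) a b c (p : C1) :
  open U -> U p -> (a != 0) || (b != 0) ->
  @defining_function _ _ plane (id_chart U) (halfplane a b c) p (linear_fun a b c).
Proof.
move=> oU Up ab; split=> //; exists U; split; split=> //; rewrite ?id_chart_img//.
- apply: affine_smooth; exists (- c), (fun j => (row_mx a%:M b%:M : 'rV_(1 + 1)) 0 j).
  exact: linear_fun_affine.
- by move=> z _; rewrite /linear_fun subr_lt0.
- rewrite gradient_linear; apply/negP => /eqP /rowP g0.
  have := g0 (lshift 1 0); have := g0 (rshift 1 0).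
  rewrite row_mxEl row_mxEr !mxE eqxx !mulr1n => b0 a0.
  by move: ab; rewrite a0 b0 eqxx.
Qed.

Lemma outward_halfplane (U : set C1) a b c (p v : C1) :
  open U -> U p -> 0 < a * X v + b * Y v ->
  @outward _ _ plane (id_chart U) (halfplane a b c) p v.
Proof.
move=> oU Up v0; exists (linear_fun a b c).
  apply: defining_halfplane => //; rewrite -negb_and; apply/negP.
  by move=> /andP[/eqP a0 /eqP b0]; move: v0; rewrite a0 b0 !mul0r addr0 ltxx.
rewrite gradient_linear mxE big_split_ord !big_ord1 /to_real ![_^T _ _]mxE.
by rewrite !(row_mxEl, row_mxEr) !mxE eqxx !mulr1n /= [_ * a]mulrC [_ * b]mulrC.
Qed.

Lemma bdry_open (A : set C1) p : open A ->
  @bdry _ _ plane A p <-> closure A p /\ ~ A p.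
Proof. by move=> /interior_id oA; rewrite /bdry oA. Qed.

Lemma bdry_halfplane a b c z : (a != 0) || (b != 0) ->
  @bdry _ _ plane (halfplane a b c) z <-> a * X z + b * Y z = c.
Proof.
by move=> ab; rewrite bdry_open ?halfplane_boundary//; exact: open_halfplane.
Qed.

Lemma eucl_ge0 (p q : C1) : 0 <= eucl p q.
Proof. by rewrite euclE sqrtr_ge0. Qed.

Lemma manifold_distance_eucl : @manifold_distance _ _ plane eucl.
Proof.
split; last split.
- split=> [||p q|p q r].
  + exact: eucl_ge0.
  + move=> p q; split=> [pq|->]; last by rewrite /eucl subrr normr0.
    by apply/eqP; rewrite -subr_eq0 -normr_eq0 norm_eucl pq.
  + by rewrite /eucl distrC.
  + have := ler_distD q p r.
    by rewrite !norm_eucl -rmorphD lecR.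
- exact: nbhs_eucl.
- move=> i p _; exists 1 => //; exists setT; first exact: filterT.
  by move=> q r _ _ /=; rewrite !mul1r.
Qed.

Definition side (j : 'I_3) : set C1 :=
  match val j with
  | 0 => halfplane 1 0 0
  | 1 => halfplane 0 1 0
  | _ => halfplane (- 1) (- 1) 4
  end.

(** What holds for all half-planes holds for the three sides. *)
Lemma sideP (P : set C1 -> Prop) :
  (forall a b c, (a != 0) || (b != 0) -> P (halfplane a b c)) -> forall j, P (side j).
Proof.
move=> hP [[|[|[|]]]//= ?]; apply: hP; by rewrite ?oppr_eq0 oner_eq0 ?orbT.
Qed.

Definition triangle : set C1 := @total_domain _ _ plane 3 side.

Lemma triangleP z : triangle z <-> [/\ X z < 0, Y z < 0 & - 4 < X z + Y z].
Proof.
split=> [h|[hx hy hxy]].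
  have := h (@Ordinal 3 0 isT); have := h (@Ordinal 3 1 isT).
  have := h (@Ordinal 3 2 isT).
  by rewrite /side /halfplane/= => ? ? ?; split; lra.
by move=> [[|[|[|]]]//= ?]; rewrite /side /halfplane/=; lra.
Qed.

Lemma open_triangle : open triangle.
Proof.
rewrite (_ : triangle = side (@Ordinal 3 0 isT) `&` side (@Ordinal 3 1 isT) `&`
    side (@Ordinal 3 2 isT)).
  by apply: openI; [apply: openI|]; exact: open_halfplane.
apply/seteqP; split => [z h|z [[]]]; first by split; [split|]; exact: h.
by rewrite /side /halfplane/= => ? ? ?; apply/triangleP; split; lra.
Qed.

Lemma convex_triangle : convex_C1 triangle.
Proof.
move=> p q t hp hq t01 j; apply: (@sideP (@convex_C1 R)) => //.
by move=> a b c _; exact: convex_halfplane.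
Qed.

Lemma triangle_box z : triangle z -> `|X z| <= 4 /\ `|Y z| <= 4.
Proof. by move=> /triangleP[? ? ?]; rewrite !ler_norml; lra. Qed.

(** From the vertical side, corner included, one enters the triangle in the
    direction of [- (1, 1)]. *)
Lemma bdry_triangle_vertical z : X z = 0 -> - 4 < Y z <= 0 ->
  @bdry _ _ plane triangle z.
Proof.
move=> x0 /andP[y4 y0]; apply/bdry_open; first exact: open_triangle.
split; last by move=> /triangleP[]; rewrite x0 ltxx.
apply: (@closure_line _ _ _ (- 1) (- 1)); near=> t.
have t0 : 0 < t by [].
have t1 : t < (Y z + 4) / 2.
  by near: t; apply: nbhs_right_lt; lra.
by apply/triangleP; rewrite X_pt Y_pt x0; split; lra.
Unshelve. all: by end_near. Qed.

Lemma bdry_triangle z : @bdry _ _ plane triangle z ->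
  [/\ X z <= 0, Y z <= 0, - 4 <= X z + Y z &
    [\/ X z = 0, Y z = 0 | X z + Y z = - 4]].
Proof.
move=> /(bdry_open _ open_triangle) [cz nz].
have hs j : closure (side j) z by apply: closureS cz => w; exact.
have /closure_halfplane h0 := hs (@Ordinal 3 0 isT).
have /closure_halfplane h1 := hs (@Ordinal 3 1 isT).
have /closure_halfplane h2 := hs (@Ordinal 3 2 isT).
have [? ? ?] : [/\ X z <= 0, Y z <= 0 & - 4 <= X z + Y z] by split; lra.
split=> //.
have [x0|x0] := eqVneq (X z) 0; first exact: Or31.
have [y0|y0] := eqVneq (Y z) 0; first exact: Or32.
have [w0|w0] := eqVneq (X z + Y z) (- 4); first exact: Or33.
exfalso; apply: nz; apply/triangleP; rewrite !lt_neqAle.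
by split; apply/andP; split => //; rewrite eq_sym.
Qed.

Lemma piecewise_smooth_triangle : @piecewise_smooth_domain _ _ plane 3 side.
Proof.
split=> //.
- apply: (@sideP (fun A => @is_domain _ _ plane A /\ @smooth_boundary _ _ plane A)).
  move=> a b c ab; split.
    split; first exact: open_halfplane.
      (* On the normal through 0, where the linear form takes the value c - 1. *)
      exists (pt ((c - 1) * a / (a ^+ 2 + b ^+ 2)) ((c - 1) * b / (a ^+ 2 + b ^+ 2))).
      rewrite /halfplane/= X_pt Y_pt.
      have d0 : a ^+ 2 + b ^+ 2 != 0.
        by rewrite paddr_eq0 ?sqr_ge0// !sqrf_eq0 negb_and.
      have -> : a * ((c - 1) * a / (a ^+ 2 + b ^+ 2)) +
         b * ((c - 1) * b / (a ^+ 2 + b ^+ 2)) = c - 1 by field.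
      by rewrite gtrBl.
    by apply: convex_connected; exact: convex_halfplane.
  move=> p _; exists (id_chart setT), (linear_fun a b c).
  by split; [apply: coordinate_chart_id; exact: openT|
    apply: defining_halfplane => //; exact: openT].
- split; first exact: open_triangle.
    by exists (pt (-1) (-1)); apply/triangleP; rewrite X_pt Y_pt; split; lra.
  by apply: convex_connected; exact: convex_triangle.
- exact: (compact_closure_box triangle_box).1.
Qed.

(** Two sides meet at 0, and 1 - 2 is not a CR-dimension. *)
Lemma not_generic_triangle : ~ @generic_corners _ _ plane 3 side.
Proof.
move=> /(_ [set @Ordinal 3 0 isT; @Ordinal 3 1 isT]%SET) [].
  exists (0 : C1) => j; rewrite !inE => /orP[] /eqP ->; apply/bdry_halfplane;
    by rewrite ?oner_eq0 ?orbT// /X /Y mxE !mulr0 addr0.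
by move=> d [_]; rewrite cards2/= addn2.
Qed.

End Plane.

(** * The function with a pole at the corner *)

Section Counterexample.
Context {R : realType}.
Local Notation C := R[i].
Local Notation C1 := 'rV[C]_1.

Definition pole (z : C1) : C := (z 0 0 ^+ 4)^-1.

Lemma holomorphic_pole : @holomorphic_on _ _ plane (@triangle R) pole.
Proof.
move=> i z _ /triangleP[xz _ _].
have z0 : z 0 0 != 0.
  by apply/negP => /eqP z0; move: xz; rewrite /X z0 ltxx.
have d : differentiable (fun w : C1 => w 0 0 ^+ 4) z.
  exact: (@differentiableX C C1 (fun w => w 0 0) 3 z (differentiable_coord _ _ _)).
by apply: (@differentiableV C C1 (fun w => w 0 0 ^+ 4) z d); rewrite expf_neq0.
Qed.

Lemma normc_eucl (z : C1) : Normc.normc (z 0 0) = eucl z 0.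
Proof.
by rewrite euclE /X /Y !mxE !subr0; case: (z 0 0).
Qed.

Lemma normcX (z : C) n : Normc.normc (z ^+ n) = Normc.normc z ^+ n.
Proof.
elim: n => [|n IH]; first by rewrite !expr0 Normc.normc1.
by rewrite !exprS Normc.normcM IH.
Qed.

(** The pole is a boundary point, so the distance to the boundary is at most
    the distance to the pole.  That it is positive matters as well, since a
    quotient by zero is zero. *)
Lemma polynomial_growth_pole :
  @polynomial_growth _ _ plane eucl (@triangle R) pole.
Proof.
exists 1, 4%:R; split=> // p tp.
have b0 : @bdry _ _ plane (@triangle R) (0 : C1).
  by apply: bdry_triangle_vertical; rewrite /X /Y mxE //= lexx andbT; lra.
set D := [set eucl p q | q in @bdry _ _ plane (@triangle R)].
have D0 : D !=set0 by exists (eucl p 0); exists 0.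
(* A ball around p inside the triangle contains no boundary point. *)
have [e e0 he] : exists2 e : R, 0 < e & forall q, eucl p q < e -> triangle q.
  by apply/nbhs_eucl; apply: open_nbhs_nbhs; split => //; exact: open_triangle.
have eD : lbound D e.
  move=> _ [q bq <-]; rewrite leNgt; apply/negP => /he tq.
  by have [_] := (bdry_open _ (@open_triangle R)).1 bq; apply.
have d0 : 0 < set_dist (M := plane) eucl p (@bdry _ _ plane (@triangle R)).
  by apply: lt_le_trans e0 _; exact: lb_le_inf.
have d1 : set_dist (M := plane) eucl p (@bdry _ _ plane (@triangle R)) <= eucl p 0.
  by apply: ge_inf; [exists e|exists 0].
rewrite /pole Normc.normcV normcX normc_eucl powR_mulrn ?(ltW d0)// div1r.
rewrite lef_pV2 ?posrE ?exprn_gt0 ?(lt_le_trans d0)//.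
by rewrite lerXn2r ?nnegrE ?(ltW d0) ?eucl_ge0.
Qed.

(** The factor [Y z] makes the weight vanish on the horizontal side. *)
Definition weight (z : C1) : R := cutoff (X z) * (Y z * cutoff (Y z)).

Definition psi : nn1_form (@plane R) := fun=> fun z => const_mx (weight z)%:C.

Lemma weight_support z : weight z != 0 -> [/\ `|X z| < 1, `|Y z| < 1 & Y z != 0].
Proof.
rewrite /weight mulf_eq0 negb_or (mulf_eq0 (Y z)) negb_or.
move=> /and3P[hx hy hb]; split=> //.
- by rewrite ltNge; apply/negP => /cutoff_eq0 E; move: hx; rewrite E eqxx.
- by rewrite ltNge; apply/negP => /cutoff_eq0 E; move: hb; rewrite E eqxx.
Qed.

Lemma pullback_hol_id (w : C1 -> C1) z : pullback_hol (id : C1 -> C1) w z = w z.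
Proof.
have J1 : jacobian (id : C1 -> C1) z = 1%:M.
  apply/matrixP => i j; rewrite !ord1 /jacobian /lin1_mx mxE.
  by rewrite diff_val !mxE.
rewrite /pullback_hol J1 det1 scale1r.
have -> : \matrix_(k < 1, j < 1) conjc (\det (row' j (col' k (1%:M : 'M[C]_1)))) = 1%:M.
  apply/matrixP => i j; rewrite !ord1 !mxE.
  by rewrite det_mx00 conjc1.
by rewrite mulmx1.
Qed.

Lemma coefficients_id (A : set C1) : coefficients psi (id_chart A) (psi tt).
Proof.
by move=> [] z _; rewrite (_ : transition _ _ = id)// pullback_hol_id.
Qed.

Lemma form_support_psi : compact (form_support psi) /\
  forall z, form_support psi z -> `|X z| <= 1 /\ `|Y z| <= 1.
Proof.
apply: compact_closure_box => z [i _ /= pz].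
have /weight_support[hx hy _] : weight z != 0.
  apply/negP => /eqP E; move: pz; rewrite /psi E => /eqP; apply.
  by apply/rowP => j; rewrite !mxE.
by rewrite !ltW.
Qed.

Lemma test_form_psi : test_form psi.
Proof.
split.
- by move=> [] /=; exact: coefficients_id.
- by move=> i z /=; rewrite id_chart_img => /(_ I).
- move=> i j; split.
    rewrite /smooth_on_C (_ : real_fun _ = tensor cutoff (id \* cutoff)).
      by apply: tensor_smooth; [|apply: smooth1M; [exact: smooth1_id|]];
        exact: smooth1_cutoff.
    by apply/funext => x; rewrite /real_fun mxE /= /weight X_of_real Y_of_real.
  apply: affine_smooth; exists 0, (fun=> 0) => x.
  by rewrite /real_fun mxE /= big1 ?addr0// => k _; rewrite mul0r.
- exact: form_support_psi.1.
Qed.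

(** A coordinate neighbourhood of the corner away from the third side, along
    which [pt 1 1] would point inward. *)
Definition square : set C1 := [set z | `|X z| < 2 /\ `|Y z| < 2].

Lemma open_square : open square.
Proof.
rewrite (_ : square = X @^-1` `]- 2, 2[ `&` Y @^-1` `]- 2, 2[).
  apply: openI; apply: open_comp; try exact: interval_open.
    by move=> z _; exact: continuous_X.
  by move=> z _; exact: continuous_Y.
by apply/seteqP; split => z /=; rewrite !in_itv/= -!ltr_norml.
Qed.

Lemma support_sub_square : form_support psi `<=` square.
Proof.
move=> z /form_support_psi.2 [hx hy].
by split; [apply: le_lt_trans hx _|apply: le_lt_trans hy _]; lra.
Qed.

Lemma outward_side j p : square p -> @bdry _ _ plane (@side R j) p ->
  @outward _ _ plane (id_chart square) (side j) p (pt 1 1).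
Proof.
case: j => -[|[|[|]]]//= h sp; rewrite /side /=.
- by move=> _; apply: outward_halfplane => //;
    [exact: open_square|rewrite X_pt Y_pt; lra].
- by move=> _; apply: outward_halfplane => //;
    [exact: open_square|rewrite X_pt Y_pt; lra].
move=> /bdry_halfplane; rewrite oppr_eq0 oner_eq0 => /(_ isT).
by move: sp => []; rewrite !ltr_norml; lra.
Qed.

(** The line of the vertical side, upwards: the triangle lies on its left. *)
Definition edge (x : 'rV[R]_(0 + 1)) : C1 := pt 0 (x 0 0).

Definition edge_dom (a b : R) : set 'rV[R]_(0 + 1) := [set x | a < x 0 0 < b].

Lemma open_edge_dom a b : open (edge_dom a b).
Proof.
rewrite (_ : edge_dom a b = (fun x : 'rV[R]_(0 + 1) => x 0 0) @^-1` `]a, b[).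
  apply: open_comp; last exact: interval_open.
  by move=> x _; exact: coord_continuous.
by apply/seteqP; split => x /=; rewrite in_itv.
Qed.

Lemma edge_affine (b : 'I_(1 + 1)) (x : 'rV[R]_(0 + 1)) :
  to_real (edge x) 0 b = 0 + \sum_(j < 0 + 1) (row_mx 0 1 : 'rV_(1 + 1)) 0 b * x 0 j.
Proof.
rewrite /to_real add0r (big_ord1 _ (fun j : 'I_1 => _ * x 0 j)).
by case: (split_ordP b) => j ->; rewrite !(row_mxEl, row_mxEr) !mxE !ord1 ?mul0r ?mul1r.
Qed.

Lemma real_tangent_edge x : real_tangent edge x = row_mx 0 1.
Proof.
apply/matrixP => a b; rewrite mxE.
by rewrite (affine_partial (edge_affine b) _ _).2 [a]ord1.
Qed.

Lemma edge_parametrization :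
  @boundary_parametrization _ 0 plane (id_chart square) (halfplane 1 0 0)
    (edge_dom (- 2) 2) edge.
Proof.
split.
- exact: open_edge_dom.
- move=> b; apply: affine_smooth.
  exists 0, (fun=> (row_mx 0 1 : 'rV_(1 + 1)) 0 b) => x; exact: edge_affine.
- move=> x y _ _ /(congr1 Y); rewrite !Y_pt => xy.
  by apply/rowP => j; rewrite [j]ord1.
- move=> x /=; rewrite /edge_dom /= => xW.
  have sx : square (edge x).
    by rewrite /square /= X_pt Y_pt normr0 ltr0n ltr_norml.
  split; first by rewrite id_chart_img.
    by apply/bdry_halfplane; rewrite ?oner_eq0// X_pt mulr0 mul0r addr0.
  exists (pt 1 0).
    by apply: outward_halfplane => //; [exact: open_square|rewrite X_pt Y_pt; lra].
  rewrite /positive_frame real_tangent_edge.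
  rewrite (_ : col_mx _ _ = 1%:M) ?det1 ?mulr1 ?expr0// .
  apply/matrixP => a b; case: (split_ordP a) => i ->; rewrite ?(col_mxEu, col_mxEd);
    case: (split_ordP b) => j ->; rewrite ?(row_mxEl, row_mxEr) !mxE !ord1 //=.
Qed.

(** The form is a multiple of dz, and dz / dt is the imaginary unit. *)
Lemma pullback_edge w x : pullback_real (m := 0) edge w x = w (edge x) 0 0 * (0 +i* 1).
Proof.
rewrite /pullback_real big_ord1; congr (_ * _).
rewrite (row_thin_mx (col' ord0 _)) [LHS](@det_mx11 C).
rewrite mxE /of_real [LHS]mxE ![row _ _ _ _]mxE real_tangent_edge.
by rewrite row_mxEl row_mxEr !mxE ?ord1.
Qed.

Lemma integral_rV1 (G : 'rV[R]_(0 + 1) -> R) :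
  integral_rV G = (\int[@lebesgue_measure R]_t G (const_mx t))%R.
Proof.
rewrite /=; congr (Rintegral _ _ _); apply/funext => t; congr G.
apply/rowP => j; rewrite !mxE; case: splitP => k _; rewrite ?mxE ?ord1 ?eqxx //.
by case: k.
Qed.

Definition shifted_form (e : R) (z : C1) : C1 :=
  pole (z - e%:C *: pt 1 1) *: psi tt z.

Definition edge_integral (e : R) : C :=
  integral_rV_C (edge_dom (- 2) 0) (pullback_real (m := 0) edge (shifted_form e)).

(** The vertical side covers all the boundary points where the form is
    nonzero: the weight vanishes on the horizontal side, and the third side
    is outside its support. *)
Lemma boundary_integral_edge e :
  @boundary_integral _ 0 plane 3 (id_chart square) (@side R) (shifted_form e)
    (edge_integral e).
Proof.
exists 1%N, (fun=> @Ordinal 3 0 isT), (fun=> edge_dom (- 2) 2),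
  (fun=> edge_dom (- 2) 0), (fun=> edge); split.
- by move=> _; exact: edge_parametrization.
- move=> _; split.
  + by apply: sub_sigma_algebra; exact: open_edge_dom.
  + by move=> x; rewrite /edge_dom /= => /andP[-> h]; rewrite (lt_trans h).
  + move=> x; rewrite /edge_dom /= => /andP[h1 h2].
    by apply: bdry_triangle_vertical; rewrite /edge ?X_pt ?Y_pt//; lra.
- by move=> i j _ _ _; rewrite !ord1.
- move=> p /= sp /bdry_triangle[x0 y0 xy on_edge] w0.
  have /weight_support[xs ys yn0] : weight p != 0.
    apply/negP => /eqP E; move: w0 => /eqP; apply.
    by apply/rowP => j; rewrite !mxE E mulr0.
  move: xs ys; rewrite !ltr_norml => /andP[? ?] /andP[? ?].
  have px : X p = 0.
    case: on_edge => [//|y1|?]; [|lra]. by move: yn0; rewrite y1 eqxx.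
  exists ord0, (const_mx (Y p)); last by rewrite /edge mxE -px ptK.
  have yneg : Y p < 0 by rewrite lt_neqAle yn0.
  by rewrite /edge_dom /= mxE yneg andbT; lra.
- by rewrite big_ord1.
Qed.

(** The real part of i (a + i b)^-4 is 4 a b (a^2 - b^2) / (a^2 + b^2)^4;
    here a = - e and b = t - e. *)
Definition kernel (e t : R) : R :=
  4 * e * (e - t) * (2 * e * t - t ^+ 2) / (e ^+ 2 + (t - e) ^+ 2) ^+ 4 *
  (cutoff 0 * (t * cutoff t)).

Lemma Re_shifted_form e t :
  complex.Re (pullback_real (m := 0) edge (shifted_form e) (const_mx t)) = kernel e t.
Proof.
rewrite pullback_edge /shifted_form /pole /psi /weight /edge !mxE.
rewrite X_pt Y_pt /kernel; set k := cutoff 0 * _.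
have -> : t*i - e%:C * (1 +i* 1) = (- e) +i* (t - e).
  apply/eqP; rewrite eq_complex /=. by apply/andP; split; apply/eqP; ring.
rewrite -!exprVn.
have -> : ((- e) +i* (t - e))^-1 =
    (- e / (e ^+ 2 + (t - e) ^+ 2)) +i* (- (t - e) / (e ^+ 2 + (t - e) ^+ 2)).
  have invE (a b : R) : (a +i* b)^-1 =
      (a / (a ^+ 2 + b ^+ 2)) -i* (b / (a ^+ 2 + b ^+ 2)) by [].
  by rewrite invE sqrrN !mulNr.
set n := (e ^+ 2 + _)^-1.
by rewrite !exprS expr0 /=; ring.
Qed.

(** For t <= 0 both [2 * e * t - t ^+ 2] and [t * cutoff t] are nonpositive.
    Without a constant sign the integral could converge by cancellation. *)
Lemma kernel_ge0 e t : 0 < e -> t <= 0 -> 0 <= kernel e t.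
Proof.
move=> e0 t0; rewrite /kernel -mulrA; apply: mulr_le0.
  by apply: mulr_ge0_le0; [rewrite !mulr_ge0//; lra|nra].
apply: mulr_ge0_le0.
  by rewrite invr_ge0 exprn_ge0// addr_ge0// sqr_ge0.
by rewrite mulr_ge0_le0 ?cutoff_ge0// mulr_le0_ge0 ?cutoff_ge0.
Qed.

Lemma cutoff_lower (t : R) : `|t| <= 1 / 2 -> expR (- 2) ^+ 2 <= cutoff t.
Proof.
have flat_lower (s : R) : 1 / 2 <= s -> expR (- 2) <= flat 1 s.
  move=> s2; have s0 : 0 < s by lra.
  rewrite /flat s0 hornerC mul1r ler_expR lerN2 -[leRHS]invrK lef_pV2 ?posrE//.
  by lra.
rewrite ler_norml => /andP[? ?]; rewrite /cutoff expr2.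
by apply: ler_pM; rewrite ?expR_ge0//; apply: flat_lower; lra.
Qed.

(** The constant of [kernel_lower]: for -2 e <= t <= -e the numerator is at
    least 24 e^5, the denominator at most (10 e^2)^4, and each of the two
    cutoffs at least exp (-2)^2. *)
Definition blowup : R := 24 / 10 ^+ 4 * (expR (- 2) ^+ 2) ^+ 2.

Lemma blowup_gt0 : 0 < blowup.
Proof. by rewrite !mulr_gt0// ?invr_gt0 ?exprn_gt0 ?expR_gt0//. Qed.

Lemma kernel_lower e t : 0 < e -> e <= 1 / 4 -> - (2 * e) <= t <= - e ->
  blowup / e ^+ 3 <= kernel e t.
Proof.
move=> e0 e4 /andP[t1 t2].
have ct : expR (- 2) ^+ 2 <= cutoff t.
  by apply: cutoff_lower; rewrite ler_norml; lra.
have c0 : expR (- 2) ^+ 2 <= cutoff (0 : R).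
  by apply: cutoff_lower; rewrite normr0; lra.
set b := expR (- 2) ^+ 2 in ct c0.
have b0 : 0 < b by rewrite exprn_gt0// expR_gt0.
have D0 : 0 < e ^+ 2 + (t - e) ^+ 2 by rewrite ltr_pwDl ?exprn_gt0 ?sqr_ge0.
have D1 : e ^+ 2 + (t - e) ^+ 2 <= 10 * e ^+ 2 by nra.
have -> : kernel e t = (4 * e * (e - t) * (t ^+ 2 - 2 * e * t) * - t) /
    (e ^+ 2 + (t - e) ^+ 2) ^+ 4 * (cutoff 0 * cutoff t).
  by rewrite /kernel; ring.
have -> : blowup / e ^+ 3 = (24 * e ^+ 5) / (10 * e ^+ 2) ^+ 4 * (b * b).
  by rewrite /blowup -/b; field; rewrite gt_eqF.
(* e - t >= 2 e, t^2 - 2 e t >= 3 e^2 and - t >= e. *)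
have n0 : 24 * e ^+ 5 <= 4 * e * (e - t) * (t ^+ 2 - 2 * e * t) * - t.
  have -> : 24 * e ^+ 5 = 4 * e * (2 * e) * (3 * e ^+ 2) * e by ring.
  apply: ler_pM; [by rewrite !mulr_ge0 ?exprn_ge0 ?(ltW e0)|exact: ltW| |by lra].
  apply: ler_pM; [by rewrite !mulr_ge0 ?(ltW e0)| | |by nra].
    by rewrite mulr_ge0// exprn_ge0// ltW.
  by apply: ler_wpM2l; [rewrite mulr_ge0 ?(ltW e0)|lra].
apply: ler_pM.
- by rewrite divr_ge0 ?mulr_ge0 ?exprn_ge0 ?mulr_ge0 ?exprn_ge0 ?(ltW e0).
- by rewrite mulr_ge0 ?(ltW b0).
- apply: ler_pM => //.
  + by rewrite mulr_ge0 ?exprn_ge0 ?(ltW e0).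
  + by rewrite invr_ge0 exprn_ge0// mulr_ge0// exprn_ge0// ltW.
  + rewrite lef_pV2 ?posrE ?exprn_gt0 ?mulr_gt0 ?exprn_gt0//.
    by rewrite lerXn2r ?nnegrE ?mulr_ge0 ?exprn_ge0 ?(ltW e0) ?(ltW D0).
- by apply: ler_pM; rewrite ?(ltW b0).
Qed.

Lemma continuous_cutoff : continuous (@cutoff R).
Proof.
move=> t; apply/differentiable_continuous/derivable1_diffP.
by have := @smooth1_cutoff R 0%N t; exact.
Qed.

Lemma continuous_kernel e : 0 < e -> continuous (kernel e).
Proof.
move=> e0 t.
have cid : {for t, continuous (id : R -> R)} by exact: cvg_id.
have cc (a : R) : {for t, continuous (fun=> a : R)} by exact: cst_continuous.
have cX (g : R -> R) n : {for t, continuous g} -> {for t, continuous (fun s => g s ^+ n)}.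
  by move=> cg; apply: (@continuous_comp _ _ _ g (fun s => s ^+ n)) => //;
    exact: exprn_continuous.
have cM (g h : R -> R) : {for t, continuous g} -> {for t, continuous h} ->
  {for t, continuous (fun s => g s * h s)} by exact: continuousM.
have cD (g h : R -> R) : {for t, continuous g} -> {for t, continuous h} ->
  {for t, continuous (fun s => g s + h s)} by exact: continuousD.
have cN (g : R -> R) : {for t, continuous g} ->
  {for t, continuous (fun s => - g s)} by exact: continuousN.
have ck := @continuous_cutoff t.
apply: (cM (fun s => _ / _)); last first.
  by apply: (cM) => //; exact: (cM).
apply: (cM _ (fun s => _^-1)); last first.
  apply: (@continuousV _ _ (fun s => (e ^+ 2 + (s - e) ^+ 2) ^+ 4)).
    by rewrite expf_neq0// gt_eqF// ltr_pwDl ?exprn_gt0 ?sqr_ge0.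
  by apply: (cX _ 4); apply: (cD) => //; apply: (cX _ 2); exact: (cD).
apply: (cM); first by apply: (cM) => //; apply: (cD) => //; exact: (cN).
by apply: (cD); [exact: (cM)|apply: (cN); exact: (cX)].
Qed.

Local Notation mu := (@lebesgue_measure R).

Lemma Re_edge_integral e :
  complex.Re (edge_integral e) = (\int[mu]_(t in `]- 2, 0[) kernel e t)%R.
Proof.
rewrite [LHS]integral_rV1 [RHS]Rintegral_mkcond.
apply: eq_Rintegral => t _; rewrite Re_shifted_form patchE indicE.
rewrite (_ : (_ \in edge_dom _ _) = (t \in `]- 2, 0[%classic)).
  by case: ifP; rewrite ?mul1r ?mul0r.
by apply/idP/idP; rewrite !inE /edge_dom /= in_itv/= mxE.
Qed.

(** The interval from -2 e to -e has length e, and the kernel is at least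
    [blowup / e ^+ 3] there. *)
Lemma Re_edge_integral_lower e : 0 < e -> e <= 1 / 4 ->
  blowup / e ^+ 2 <= complex.Re (edge_integral e).
Proof.
move=> e0 e4; rewrite Re_edge_integral.
have ik : mu.-integrable `]- 2, 0[ (EFin \o kernel e).
  apply: (@integrableS _ _ _ mu `[- 2, 0]) => //.
    by apply: subset_itv; rewrite bnd_simp.
  apply: continuous_compact_integrable; first exact: segment_compact.
  by apply: continuous_subspaceT; exact: continuous_kernel.
have sub : `[- (2 * e), - e] `<=` `]- 2, 0[.
  by move=> t /=; rewrite !in_itv/=; lra.
have -> : blowup / e ^+ 2 = (\int[mu]_(t in `[- (2 * e), - e]) (blowup / e ^+ 3))%R.
  rewrite Rintegral_cst// /= lebesgue_measure_itv/= lte_fin ifT; last by lra.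
  by rewrite -EFinD /=; field; rewrite gt_eqF.
rewrite Rintegral_mkcond [leRHS]Rintegral_mkcond.
apply: le_Rintegral => //.
- rewrite -restrict_EFin -integrable_mkcond//.
  apply: continuous_compact_integrable; first exact: segment_compact.
  by apply: continuous_subspaceT; exact: cst_continuous.
- by rewrite -restrict_EFin -integrable_mkcond.
move=> t _; rewrite !patchE; case: ifPn => [|_].
  rewrite inE => h; rewrite ifT; last by rewrite inE; exact: sub.
  by apply: kernel_lower => //; move: h; rewrite /= in_itv.
case: ifPn => //; rewrite inE /= in_itv /= => /andP[_ t0].
by apply: kernel_ge0 => //; exact: ltW.
Qed.

Lemma edge_integral_diverges (l : C) : ~ (edge_integral e @[e --> (0 : R)^'+] --> l).
Proof.
move=> cvl.
have : \forall e \near (0 : R)^'+, complex.Re (edge_integral e) < complex.Re l + 1.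
  have nl : nbhs l [set z : C | complex.Re z < complex.Re l + 1].
    apply/nbhs_ballP; exists 1 => //= z; rewrite -ball_normE /= => lz.
    have : `|complex.Re z - complex.Re l| < 1.
      rewrite distrC -ltcR (le_lt_trans _ lz)// normc_def lecR -sqrtr_sqr.
      rewrite ler_sqrt ?addr_ge0 ?sqr_ge0//.
      by rewrite (_ : complex.Re (l - z) = complex.Re l - complex.Re z)
        ?lerDl ?sqr_ge0//; case: (l) (z) => ? ? [].
    by rewrite ltr_norml => /andP[_]; rewrite ltrBlDl addrC.
  exact: (cvl _ nl).
set r := complex.Re l + 1 => upper.
have b0 := blowup_gt0.
have lower : \forall e \near (0 : R)^'+, r <= complex.Re (edge_integral e).
  near=> e.
  have e0 : 0 < e by [].
  have e4 : e <= 1 / 4 by near: e; apply: nbhs_right_le; lra.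
  apply: le_trans (Re_edge_integral_lower e0 e4).
  rewrite ler_pdivlMr ?exprn_gt0//.
  have r1 : 0 < `|r| + 1 by rewrite ltr_wpDl.
  have er : e <= blowup / (`|r| + 1).
    by near: e; apply: nbhs_right_le; rewrite divr_gt0.
  rewrite ler_pdivlMr// in er.
  (* r * e^2 <= (|r| + 1) * e <= blowup, as e <= 1. *)
  have := ler_norm r => rr.
  nra.
have /filter_ex[e] : \forall e \near (0 : R)^'+, False.
  near=> e; have lo : r <= complex.Re (edge_integral e) by near: e.
  have : complex.Re (edge_integral e) < r by near: e.
  by rewrite ltNge lo.
by [].
Unshelve. all: by end_near. Qed.

End Counterexample.

Theorem proposition1p2 (R : realType) :
  exists (m : nat) (M : complexManifold R m.+1) (dist : M -> M -> R)
         (N : nat) (Om : 'I_N -> set M) (f : M -> complex R),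
    [/\ manifold_distance dist,
        piecewise_smooth_domain Om /\ ~ generic_corners Om,
        holomorphic_on (total_domain Om) f,
        polynomial_growth dist (total_domain Om) f
      & ~ exists gamma : nn1_form M -> complex R, boundary_current Om f gamma].
Proof.
exists 0%N, plane, eucl, 3%N, side, pole; split.
- exact: manifold_distance_eucl.
- by split; [exact: piecewise_smooth_triangle|exact: not_generic_triangle].
- exact: holomorphic_pole.
- exact: polynomial_growth_pole.
move=> [gamma [_ bcf]]; apply: (@edge_integral_diverges R (gamma psi)).
apply: (bcf (id_chart square) psi (psi tt) (pt 1 1)).
- by apply: coordinate_chart_id; exact: open_square.
- exact: test_form_psi.
- exact: support_sub_square.
- exact: coefficients_id.
- exact: outward_side.
- by near=> e; exact: boundary_integral_edge.
Unshelve. all: by end_near. Qed.
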